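(* The zero equilibrium $\mathbf V=0$, $\mathbf E=0$, $\mathbf B=0$ of the system $$\partial_t\mathbf V+(\mathbf V\cdot\nabla)\mathbf V=-(\mathbf E+[\mathbf V\times\mathbf B(t)]),\qquad \partial_t\mathbf E+\mathbf V\,\operatorname{div}\mathbf E=\mathbf V,\qquad \dot{\mathbf B}(t)+\operatorname{curl}\mathbf E=0,$$ $x\in\mathbb R^3$, $t\ge0$, is unstable in the sense of Lyapunov in the class of all affine solutions, i.e. solutions of the form $\mathbf V=Q(t)\mathbf x$, $\mathbf E=R(t)\mathbf x$, $\mathbf B=\mathbf B(t)$, where $Q(t)$ and $R(t)$ are $3\times3$ real matrices depending on $t$.
   Context: Here $\mathbf x$ is the radius vector of the point $x\in\mathbb R^3$; $\mathbf V$ is the electron velocity, $\mathbf E$ the electric field, $\mathbf B$ the magnetic field; the density is $n=1-\operatorname{div}\mathbf E>0$. For affine solutions the system becomes a system of ordinary differential equations for the entries of $Q(t)$, $R(t)$ and the components of $\mathbf B(t)$, with constant initial data $(\mathbf V,\mathbf E,\mathbf B)|_{t=0}=(Q_0\mathbf x,R_0\mathbf x,\mathbf B_0)$. Lyapunov instability is understood for this system: there is a neighborhood of $(Q,R,\mathbf B)=(0,0,0)$ such that arbitrarily close to $(0,0,0)$ there are initial data $(Q_0,R_0,\mathbf B_0)$ whose solution leaves that neighborhood (or ceases to exist). *)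

(* Defs.v *)
From HB Require Import structures.
From mathcomp Require Import all_boot all_order all_algebra.
From mathcomp Require Import all_classical all_reals all_analysis.

Set Implicit Arguments.
Unset Strict Implicit.
Unset Printing Implicit Defensive.

Import Order.TTheory GRing.Theory Num.Theory.
Import numFieldNormedType.Exports.

Local Open Scope classical_set_scope.
Local Open Scope ring_scope.

Section VectorCalculus.
Context {K : realType}.
Implicit Types (u v x : 'cV[K]_3) (F G : 'cV[K]_3 -> 'cV[K]_3) (i j : 'I_3).

Definition partial j F x : 'cV[K]_3 := 'D_(delta_mx j 0) F x.

Definition div F x : K := \sum_(i < 3) partial i F x i 0.

(* Index arithmetic in 'I_3 is modulo 3. *)
Definition curl F x : 'cV[K]_3 :=
  \col_i (partial (i + 1) F x (i + 2%:R) 0 - partial (i + 2%:R) F x (i + 1) 0).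

Definition cross u v : 'cV[K]_3 :=
  \col_i (u (i + 1) 0 * v (i + 2%:R) 0 - u (i + 2%:R) 0 * v (i + 1) 0).

(* (F . nabla) G *)
Definition advection F G x : 'cV[K]_3 :=
  \sum_(j < 3) F x j 0 *: partial j G x.

End VectorCalculus.

(* Solutions for t >= 0 of the cold plasma equations with spatially homogeneous
   magnetic field and positive density.  The fields are functions on all of K,
   but their values at t < 0 are irrelevant: the two-sided derivative at t = 0
   costs no generality, since a field that is right-differentiable at 0 can be
   continued to t < 0 by its tangent. *)
Record cold_plasma_solution (K : realType)
    (V E : K -> 'cV[K]_3 -> 'cV[K]_3) (B : K -> 'cV[K]_3) : Prop := {
  V_derivable : forall t x, 0 <= t -> derivable (V ^~ x) t 1;
  E_derivable : forall t x, 0 <= t -> derivable (E ^~ x) t 1;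
  B_derivable : forall t, 0 <= t -> derivable B t 1;
  V_differentiable : forall t x, 0 <= t -> differentiable (V t) x;
  E_differentiable : forall t x, 0 <= t -> differentiable (E t) x;
  density_gt0 : forall t x, 0 <= t -> 0 < 1 - div (E t) x;
  momentum_eq : forall t x, 0 <= t ->
    derive1 (V ^~ x) t + advection (V t) (V t) x
    = - (E t x + cross (V t x) (B t));
  electric_eq : forall t x, 0 <= t ->
    derive1 (E ^~ x) t + div (E t) x *: V t x = V t x;
  magnetic_eq : forall t x, 0 <= t ->
    derive1 B t + curl (E t) x = 0 }.

Definition linear_field (K : realType) (M : 'M[K]_3) : 'cV[K]_3 -> 'cV[K]_3 :=
  fun x => M *m x.

(* s t = (Q t, R t, B t): the fields V = Q x, E = R x, B. *)
Definition affine_solution (K : realType)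
    (s : K -> 'M[K]_3 * 'M[K]_3 * 'cV[K]_3) : Prop :=
  cold_plasma_solution (fun t => linear_field (s t).1.1)
                       (fun t => linear_field (s t).1.2)
                       (fun t => (s t).2).

Definition affine_data (K : realType) : set ('M[K]_3 * 'M[K]_3 * 'cV[K]_3) :=
  [set s0 | forall x, 0 < 1 - div (linear_field s0.1.2) x].

(* [sol] is the set of the solutions that exist for all t >= 0 and [data] the
   set of admissible initial data.  That the solution issued from [s0] leaves
   [U] or ceases to exist means that no solution existing for all t >= 0 with
   initial value [s0] stays in [U]. *)
Definition lyapunov_unstable (K : realType) (S : topologicalType)
    (data : set S) (sol : set (K -> S)) (p : S) : Prop :=
  exists2 U, nbhs p U &
    forall W, nbhs p W ->
      exists s0, [/\ W s0, data s0 &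
        ~ exists s, [/\ sol s, s 0 = s0 & forall t, 0 <= t -> U (s t)]].

(* Main.v *)
(* If B = curl V initially, the frozen-in field curl V - B vanishes for all time
   and the equations reduce to Q' = - Q^T Q - R, R' = (1 - tr R) Q.  Planar
   solutions invariant under rotations about the third axis are governed by
   p = tr Q, r = tr R, w = (curl V)_3, s = (curl E)_3:
     p' = - r - (p^2 + w^2) / 2,  r' = (1 - r) p,  w' = - s,  s' = (1 - r) w,
   two oscillators in 1:1 resonance.  With X = p^2 + r^2, Y = w^2 + s^2,
   U = p w + r s, T = p s - r w, averaging gives
     X' = 7 U T / 12,  Y' = U T / 12,  U' = Y T / 4,  T' = (X + Y) U / 24,
   which has the growing ray X = 7 Y, U = sqrt 3 Y, T = 2 Y.  The quadratic form
   3 (U + T) - X - Y is positive on a cone around this ray; with cubic and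
   quartic corrections it becomes a Chetaev function. *)
Require Import Defs.
From mathcomp Require Import all_boot all_order all_algebra.
From mathcomp Require Import all_classical all_reals all_analysis.
From mathcomp Require Import ring lra.

Set Implicit Arguments.
Unset Strict Implicit.
Unset Printing Implicit Defensive.

Import Order.TTheory GRing.Theory Num.Theory.
Import numFieldNormedType.Exports.

Local Open Scope classical_set_scope.
Local Open Scope ring_scope.

(** * Differential inequalities *)

Section Derive.
Context {K : realType}.
Implicit Types (f g df : K -> K) (t a b : K).

Lemma is_derive_continuous f t a : is_derive t (1 : K) f a ->
  {for t, continuous f}.
Proof.
by move=> [fa _]; exact/differentiable_continuous/derivable1_diffP.
Qed.

Lemma is_derive_MVT f df x y : x < y ->
    (forall t, x <= t -> is_derive t (1 : K) f (df t)) ->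
  exists2 c, x < c < y & f y - f x = df c * (y - x).
Proof.
move=> xy fdf; have [||c cxy e] := @MVT K f df x y xy.
- by move=> t; rewrite in_itv /= => /andP[/ltW xt _]; exact: fdf.
- apply: derivable_within_continuous => t; rewrite in_itv /= => /andP[xt _].
  by have [] := fdf t xt.
- by exists c => //; move: cxy; rewrite in_itv.
Qed.

(** The product [f t * expR (- C * t)] has nonpositive derivative, so by the mean value theorem it
    never exceeds [f 0]. *)
Lemma gronwall_le0 f df (C : K) :
    (forall t, 0 <= t -> is_derive t (1 : K) f (df t)) ->
    (forall t, 0 <= t -> df t <= C * f t) -> f 0 <= 0 ->
  forall t, 0 <= t -> f t <= 0.
Proof.
move=> fdf dfC f0 t; rewrite le_eqVlt => /predU1P[<- //|t0].
pose g u := f u * expR (- C * u).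
pose dg u := (df u - C * f u) * expR (- C * u).
have gdg (u : K) : 0 <= u -> is_derive u (1 : K) g (dg u).
  move=> u0; have := fdf u u0 => fu; apply: is_derive_eq.
  by rewrite /dg /GRing.scale /=; ring.
have [c /andP[c0 _] gtg0] := is_derive_MVT t0 gdg.
have : dg c * (t - 0) <= 0.
  rewrite mulr_le0_ge0 ?subr_ge0 ?(ltW t0)// mulr_le0_ge0 ?expR_ge0//.
  by rewrite subr_le0 dfC// ltW.
rewrite -gtg0 subr_le0 {2}/g mulr0 expR0 mulr1 => /le_trans/(_ f0).
by rewrite /g pmulr_lle0 ?expR_gt0.
Qed.

(** The sign of the derivative is known only where [f] is positive. Monotonicity is therefore used
    up to the infimum of the times with [f <= c], for a level [c] between 0 and [f 0]; continuity at
    that infimum gives the contradiction. *)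
Lemma le_of_derive_ge0 f df : 0 < f 0 ->
    (forall t, 0 <= t -> is_derive t (1 : K) f (df t)) ->
    (forall t, 0 <= t -> 0 < f t -> 0 <= df t) ->
  forall t, 0 <= t -> f 0 <= f t.
Proof.
move=> f0 fdf df0 T T0; rewrite leNgt; apply/negP => fT.
(* The term [f T] puts [T] in [S]; the term [f 0 / 2] keeps [c] positive. *)
pose c := Num.max (f T) (f 0 / 2).
have c0 : 0 < c by rewrite lt_max divr_gt0 ?orbT.
have cf : c < f 0 by rewrite gt_max fT /= ltr_pdivrMr// ltr_pMr// ltr1n.
pose S : set K := [set u | 0 <= u /\ f u <= c].
have S0 : S T by split => //; rewrite le_max lexx.
have lbS : lbound S 0 by move=> u [].
have infS : has_inf S by split; [exists T|exists 0].
have a0 : 0 <= inf S by exact: lb_le_inf (ex_intro _ _ S0) lbS.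
have fa : f 0 <= f (inf S).
  move: a0; rewrite le_eqVlt => /predU1P[<- //|a0].
  have [d /andP[d0 da] e] := is_derive_MVT a0 fdf.
  rewrite -subr_ge0 e mulr_ge0 ?subr_ge0 ?(ltW a0)//.
  apply: df0; first exact: ltW.
  (* A time before [inf S] lies outside [S], so [f] exceeds [c] there. *)
  apply: (lt_trans c0); rewrite ltNge; apply/negP => fd.
  move: da; rewrite ltNge => /negP; apply.
  by apply: (ge_inf infS.2); split => //; exact: ltW.
have /cvgr_gt /(_ c (lt_le_trans cf fa)) /nbhs_ballP[e /= e0 be] :=
  is_derive_continuous (fdf _ a0).
have [u [u0 uc] ue] := inf_adherent e0 infS.
suff /be /= : ball (inf S) e u by rewrite ltNge uc.
rewrite /ball /= ltr_norml; have := ge_inf infS.2 (conj u0 uc); lra.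
Qed.
End Derive.

(** * The Chetaev function *)

Section Chetaev.
Context {K : realType}.
Implicit Types (p r w s m : K).

Definition chetaev2 p r w s : K :=
  3 * (p * w + r * s) + 3 * (p * s - r * w)
  - (p ^+ 2 + r ^+ 2) - (w ^+ 2 + s ^+ 2).

(* The corrections [chetaev3] and [chetaev4] remove the cubic terms and the
   nonresonant quartic terms from the derivative of [chetaev2] along the flow. *)
Definition chetaev3 p r w s : K :=
  - p ^+ 2 * r - p ^+ 2 * w / 2 + 3 * p ^+ 2 * s / 2 + p * r * s
  - 4 * p * w * s / 3 - 4 * r ^+ 3 / 3 - r ^+ 2 * w + 3 * r ^+ 2 * s
  + r * w ^+ 2 / 3 - 4 * r * s ^+ 2 / 3 - w ^+ 3 / 2 + 3 * w ^+ 2 * s / 2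
  + s ^+ 3.

Definition chetaev4 p r w s : K :=
  - p ^+ 2 * r ^+ 2 - 3 * p ^+ 2 * r * w / 8 + 3 * p ^+ 2 * r * s / 2
  + 5 * p * r ^+ 2 * s / 8 - 4 * p * r * w * s / 3 + 3 * p * w * s ^+ 2 / 4
  + p * s ^+ 3 / 8 - 3 * r ^+ 4 / 2 - 3 * r ^+ 3 * w / 4 + 3 * r ^+ 3 * s
  - 5 * r ^+ 2 * s ^+ 2 / 3 - 3 * r * w ^+ 3 / 8 + 3 * r * w ^+ 2 * s / 4
  - r * w * s ^+ 2 / 4 + 3 * r * s ^+ 3 / 2 - w ^+ 2 * s ^+ 2 / 3
  - s ^+ 4 / 6.

Definition chetaev p r w s : K :=
  chetaev2 p r w s + chetaev3 p r w s + chetaev4 p r w s.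

(** The derivative [3 (U' + T') - X' - Y'] of [chetaev2] along the averaged system. *)
Definition resonant4 p r w s : K :=
  let X := p ^+ 2 + r ^+ 2 in let Y := w ^+ 2 + s ^+ 2 in
  let U := p * w + r * s in let T := p * s - r * w in
  (X + Y) * U / 8 + 3 * Y * T / 4 - 2 * U * T / 3.

(** The derivative of [chetaev4] along the quadratic part of the vector field. *)
Definition remainder5 p r w s : K :=
  3 * p ^+ 3 * r ^+ 2 + 3 * p ^+ 3 * r * w / 4 - 3 * p ^+ 3 * r * s
  - 3 * p ^+ 2 * r ^+ 2 * w / 2 - 25 * p ^+ 2 * r ^+ 2 * s / 16
  + 2 * p ^+ 2 * r * w * s - 3 * p ^+ 2 * w * s ^+ 2 / 8
  - p ^+ 2 * s ^+ 3 / 16 + 6 * p * r ^+ 4 + 13 * p * r ^+ 3 * w / 8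
  - 9 * p * r ^+ 3 * s + 7 * p * r ^+ 2 * w ^+ 2 / 3
  + 10 * p * r ^+ 2 * s ^+ 2 / 3 + 3 * p * r * w ^+ 3 / 4
  - 15 * p * r * w ^+ 2 * s / 4 - p * r * w * s ^+ 2 / 8
  - 3 * p * r * s ^+ 3 / 2 - 3 * r ^+ 4 * w + 10 * r ^+ 3 * w * s / 3
  - 3 * r ^+ 2 * w ^+ 3 / 4 + 3 * r ^+ 2 * w ^+ 2 * s / 16
  - 9 * r ^+ 2 * w * s ^+ 2 / 2 + 4 * r * w ^+ 3 * s / 3
  + 2 * r * w * s ^+ 3 / 3 - 3 * w ^+ 3 * s ^+ 2 / 8 - w ^+ 2 * s ^+ 3 / 16.

Lemma is_derive_chetaev (p r w s : K -> K) t :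
    is_derive t (1 : K) p (- r t - (p t ^+ 2 + w t ^+ 2) / 2) ->
    is_derive t (1 : K) r ((1 - r t) * p t) ->
    is_derive t (1 : K) w (- s t) -> is_derive t (1 : K) s ((1 - r t) * w t) ->
  is_derive t (1 : K) (fun u => chetaev (p u) (r u) (w u) (s u))
    (resonant4 (p t) (r t) (w t) (s t) + remainder5 (p t) (r t) (w t) (s t)).
Proof.
move=> dp dr dw ds; rewrite /chetaev /chetaev2 /chetaev3 /chetaev4.
apply: is_derive_eq.
by rewrite /GRing.scale /resonant4 /remainder5 /=; field.
Qed.

(* The degrees [j] and [k] are kept apart so that [apply] never has to solve
   [j + k = n] for [j] and [k]. *)
Lemma norm_leD m j k (x y a b : K) :
    `|x| <= a * m ^+ j -> `|y| <= b * m ^+ k -> j = k ->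
  `|x + y| <= (a + b) * m ^+ j.
Proof.
move=> xa + jk; rewrite -jk mulrDl => yb.
by rewrite (le_trans (ler_normD _ _))// lerD.
Qed.

Lemma norm_leM m j k (x y a b : K) :
    `|x| <= a * m ^+ j -> `|y| <= b * m ^+ k ->
  `|x * y| <= a * b * m ^+ (j + k).
Proof. by move=> xa yb; rewrite normrM exprD mulrACA ler_pM. Qed.

Lemma norm_leX m k n (x a : K) : `|x| <= a * m ^+ k ->
  `|x ^+ n| <= a ^+ n * m ^+ (k * n).
Proof.
by move=> xa; rewrite normrX exprM -exprMn lerXn2r ?nnegrE ?(le_trans _ xa).
Qed.

Lemma norm_leN m k (x a : K) : `|x| <= a * m ^+ k -> `|- x| <= a * m ^+ k.
Proof. by rewrite normrN. Qed.

Lemma norm_le_const m (c : K) : `|c| <= `|c| * m ^+ 0.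
Proof. by rewrite mulr1. Qed.

Lemma norm_le_degree m j k (x a : K) : `|x| <= a * m ^+ j -> j = k ->
  `|x| <= a * m ^+ k.
Proof. by move=> xa <-. Qed.

(** Follows the syntax of the polynomial: the constant is an existential variable assembled by
    unification, and only degrees are compared by computation. *)
Ltac homogeneous_bound := apply: norm_le_degree; repeat first [eassumption
  | reflexivity | apply: norm_leD | apply: norm_leN | apply: norm_leX
  | apply: norm_leM | exact: norm_le_const].

Definition order_bounded k (F : K -> K -> K -> K -> K) :=
  exists2 C, 0 <= C & forall m p r w s, `|p| <= m -> `|r| <= m -> `|w| <= m ->
    `|s| <= m -> `|F p r w s| <= C * m ^+ k.

Lemma order_boundedI k F :
    (exists C, forall m p r w s, `|p| <= 1 * m ^+ 1 -> `|r| <= 1 * m ^+ 1 ->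
      `|w| <= 1 * m ^+ 1 -> `|s| <= 1 * m ^+ 1 -> `|F p r w s| <= C * m ^+ k) ->
  order_bounded k F.
Proof.
move=> [C FC]; exists C => [|m p r w s].
  (* The bound at the origin with [m = 1] shows that [C] is nonnegative. *)
  have := FC 1 0 0 0 0; rewrite normr0 !expr1n !mulr1 ler01.
  by move=> /(_ isT isT isT isT); exact: le_trans.
by have := FC m p r w s; rewrite !mul1r.
Qed.

Ltac order_bound := apply: order_boundedI; eexists => m p r w s hp hr hw hs;
  homogeneous_bound.

Lemma chetaev2_bound : order_bounded 2 chetaev2.
Proof. by rewrite /chetaev2; order_bound. Qed.

Lemma chetaev3_bound : order_bounded 3 chetaev3.
Proof. by rewrite /chetaev3; order_bound. Qed.

Lemma chetaev4_bound : order_bounded 4 chetaev4.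
Proof. by rewrite /chetaev4; order_bound. Qed.

Lemma remainder5_bound : order_bounded 5 remainder5.
Proof. by rewrite /remainder5; order_bound. Qed.

(** * Growth of the Chetaev function *)

(** Equal to [2 (X + 5 Y - 4 U - 2 T)]. It is a nonnegative S-procedure multiplier: subtracting its
    product with [chetaev2] from [48 * resonant4] leaves a positive definite quartic. *)
Definition multiplier2 p r w s : K :=
  2 * ((p - 2 * w - s) ^+ 2 + (r - 2 * s + w) ^+ 2).

Lemma multiplier2_bound : order_bounded 2 multiplier2.
Proof. by rewrite /multiplier2; order_bound. Qed.

Lemma resonant4_ge p r w s :
  multiplier2 p r w s * chetaev2 p r w s
  + (p ^+ 2 + r ^+ 2 + (w ^+ 2 + s ^+ 2)) ^+ 2 / 4 <= 48 * resonant4 p r w s.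
Proof.
(* The difference is a sum of squares modulo [X * Y = U ^+ 2 + T ^+ 2]. *)
pose X := p ^+ 2 + r ^+ 2; pose Y := w ^+ 2 + s ^+ 2.
pose U := p * w + r * s; pose T := p * s - r * w.
rewrite -subr_ge0 (_ : _ - _ =
  7 / 4 * (X + Y - 16 / 7 * U - 20 / 7 * T) ^+ 2
  + 8 * (Y - 3 / 2 * U + 3 / 4 * T) ^+ 2
  + 34 / 7 * (U - 3 / 34 * T) ^+ 2 + 20 / 17 * T ^+ 2).
  by rewrite !addr_ge0// mulr_ge0// ?sqr_ge0//; lra.
by rewrite /resonant4 /multiplier2 /chetaev2 /X /Y /U /T; field.
Qed.

(** Let [V = F2 + F3 + F4]. Where [V > 0], [M * F2 >= - M * (F3 + F4)], which is of order five, so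
    near the origin the quartic term dominates and [P + R] is at least a multiple of [m ^+ 4]. Since
    [V] is of order two, [V ^+ 2] is of order four. *)
Lemma growth_of_expansion (M F2 F3 F4 R P : K -> K -> K -> K -> K) :
    order_bounded 2 M -> order_bounded 2 F2 -> order_bounded 3 F3 ->
    order_bounded 4 F4 -> order_bounded 5 R ->
    (forall p r w s, 0 <= M p r w s) ->
    (forall p r w s, M p r w s * F2 p r w s
      + (p ^+ 2 + r ^+ 2 + (w ^+ 2 + s ^+ 2)) ^+ 2 / 4 <= 48 * P p r w s) ->
  exists eta C : K, [/\ 0 < eta <= 1, 0 < C &
    forall p r w s, `|p| <= eta -> `|r| <= eta -> `|w| <= eta -> `|s| <= eta ->
    0 < F2 p r w s + F3 p r w s + F4 p r w s ->
    F2 p r w s + F3 p r w s + F4 p r w s <= C /\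
    (F2 p r w s + F3 p r w s + F4 p r w s) ^+ 2 <= C * (P p r w s + R p r w s)].
Proof.
move=> [C1 C10 b1] [C2 C20 b2] [C3 C30 b3] [C4 C40 b4] [C5 C50 b5] M0 PM.
(* [D] bounds all quintic errors and [G] bounds [V] against [m ^+ 2]. *)
pose D := C1 * (C3 + C4) + 48 * C5; pose G := C2 + C3 + C4.
have D0 : 0 <= D by rewrite /D addr_ge0 ?mulr_ge0 ?addr_ge0.
have G0 : 0 <= G by rewrite /G !addr_ge0.
(* The Euclidean norm [m] is at most [2 * eta], whence [m * D <= 1 / 8]: the errors absorb at most
   half of [m ^+ 4 / 4]. *)
pose eta := (16 * (D + 1))^-1.
have D10 : 0 < 16 * (D + 1) by lra.
have eta0 : 0 < eta by rewrite invr_gt0.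
have etaD : eta * (16 * (D + 1)) = 1 by rewrite mulVf ?gt_eqF.
have etaD0 : 0 <= eta * D by rewrite mulr_ge0// ltW.
have eta1 : eta <= 1 / 16 by lra.
(* [G] bounds [V] because [m <= 1]; [384 = 8 * 48] comes from [growth] below. *)
exists eta, (1 + G + 384 * G ^+ 2); split.
  by apply/andP; split => //; lra.
  by have := sqr_ge0 G; lra.
move=> p r w s hp hr hw hs V0.
pose N := p ^+ 2 + r ^+ 2 + (w ^+ 2 + s ^+ 2).
pose m := Num.sqrt N.
have N0 : 0 <= N by rewrite !addr_ge0 ?sqr_ge0.
have mN : m ^+ 2 = N by rewrite sqr_sqrtr.
have mN2 : N ^+ 2 = m ^+ 4 by rewrite -mN -exprM.
have m0 : 0 <= m by rewrite sqrtr_ge0.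
have le_m x : x ^+ 2 <= N -> `|x| <= m.
  by move=> xN; rewrite -(@ler_pXn2r _ 2) ?nnegrE// mN real_normK ?num_real.
have [pm rm wm sm] : [/\ `|p| <= m, `|r| <= m, `|w| <= m & `|s| <= m].
  by split; apply: le_m; rewrite /N;
    move: (sqr_ge0 p) (sqr_ge0 r) (sqr_ge0 w) (sqr_ge0 s); clear; lra.
have m_eta : m <= 2 * eta.
  have sq x : `|x| <= eta -> x ^+ 2 <= eta ^+ 2.
    by move=> xe; rewrite -real_normK ?num_real// lerXn2r ?nnegrE// ltW.
  rewrite -(@ler_pXn2r _ 2) ?nnegrE//; last by rewrite mulr_ge0// ltW.
  by rewrite mN /N; move: (sq p hp) (sq r hr) (sq w hw) (sq s hs); clear; lra.
have m1 : m <= 1 by move: m_eta eta1; clear; lra.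
have mD : m * D <= 1 / 8.
  have : m * D <= 2 * eta * D by rewrite ler_wpM2r.
  by move: etaD (ltW eta0); clear; lra.
have m2 : 0 <= m ^+ 2 by rewrite exprn_ge0.
have m32 : m ^+ 3 <= m ^+ 2 by rewrite ler_wiXn2l.
have m43 : m ^+ 4 <= m ^+ 3 by rewrite ler_wiXn2l.
have m4 : 0 <= m ^+ 4 by rewrite exprn_ge0.
have V34 : `|F3 p r w s + F4 p r w s| <= (C3 + C4) * m ^+ 3.
  rewrite (le_trans (ler_normD _ _))// mulrDl lerD ?b3//.
  by rewrite (le_trans (b4 m _ _ _ _ _ _ _ _))// ler_wpM2l.
have VG : (F2 p r w s + F3 p r w s + F4 p r w s) <= G * m ^+ 2.
  rewrite (le_trans (ler_norm _))// /G -!addrA mulrDl.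
  rewrite (le_trans (ler_normD _ _))// lerD ?b2//.
  by rewrite (le_trans V34)// ler_wpM2l ?addr_ge0.
have growth : m ^+ 4 / 8 <= 48 * (P p r w s + R p r w s).
  have := PM p r w s; rewrite -/N mN2.
  have := mulr_ge0 (M0 p r w s) (ltW V0); rewrite -addrA mulrDr.
  have : `|M p r w s * (F3 p r w s + F4 p r w s)|
      <= C1 * (C3 + C4) * m ^+ 5.
    have -> : m ^+ 5 = m ^+ 2 * m ^+ 3 by rewrite -exprD.
    by rewrite normrM mulrACA ler_pM// b1.
  have := b5 m p r w s pm rm wm sm.
  have : m ^+ 4 * (m * D) <= m ^+ 4 * (1 / 8) by rewrite ler_wpM2l.
  rewrite /D !ler_norml.
  move: (M p r w s * (F3 p r w s + F4 p r w s)).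
  move: (M p r w s * F2 p r w s).
  move: (P p r w s) (R p r w s) => P' R' A B.
  by clear; move=> mD4 /andP[R5 _] /andP[_ B5] AB AP; lra.
split.
  have : G * m ^+ 2 <= G * 1 by rewrite ler_wpM2l// exprn_ile1.
  by have := sqr_ge0 G; lra.
have : (F2 p r w s + F3 p r w s + F4 p r w s) ^+ 2 <= (G * m ^+ 2) ^+ 2.
  by rewrite lerXn2r ?nnegrE ?mulr_ge0// ltW.
rewrite exprMn -exprM => /le_trans; apply.
move: (P p r w s + R p r w s) growth => dV growth.
have : G ^+ 2 * m ^+ 4 <= G ^+ 2 * (384 * dV).
  by rewrite ler_wpM2l ?sqr_ge0//; lra.
have : 0 <= (1 + G) * dV by rewrite mulr_ge0//; lra.
by lra.
Qed.
Lemma chetaev_growth : exists eta C : K, [/\ 0 < eta <= 1, 0 < C &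
  forall p r w s, `|p| <= eta -> `|r| <= eta -> `|w| <= eta -> `|s| <= eta ->
  0 < chetaev p r w s ->
  chetaev p r w s <= C /\
  chetaev p r w s ^+ 2 <= C * (resonant4 p r w s + remainder5 p r w s)].
Proof.
apply: (growth_of_expansion multiplier2_bound chetaev2_bound chetaev3_bound
  chetaev4_bound remainder5_bound _ resonant4_ge) => p r w s.
by rewrite mulr_ge0// addr_ge0 ?sqr_ge0.
Qed.

(** A positive [V] is nondecreasing, so its derivative stays at least [V 0 ^+ 2 / C], and linear
    growth contradicts [V <= C]. *)
Lemma chetaev_unbounded (p r w s : K -> K) (eta C : K) :
    0 < C ->
    (forall a b c d, `|a| <= eta -> `|b| <= eta -> `|c| <= eta -> `|d| <= eta ->
      0 < chetaev a b c d -> chetaev a b c d <= C /\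
      chetaev a b c d ^+ 2 <= C * (resonant4 a b c d + remainder5 a b c d)) ->
    (forall t : K, 0 <= t -> [/\ `|p t| <= eta, `|r t| <= eta, `|w t| <= eta
                            & `|s t| <= eta]) ->
    (forall t : K, 0 <= t ->
      [/\ is_derive t (1 : K) p (- r t - (p t ^+ 2 + w t ^+ 2) / 2),
          is_derive t (1 : K) r ((1 - r t) * p t),
          is_derive t (1 : K) w (- s t)
        & is_derive t (1 : K) s ((1 - r t) * w t)]) ->
  ~ 0 < chetaev (p 0) (r 0) (w 0) (s 0).
Proof.
move=> C0 growth bnd ode.
pose V t := chetaev (p t) (r t) (w t) (s t).
pose dV t := resonant4 (p t) (r t) (w t) (s t)
  + remainder5 (p t) (r t) (w t) (s t).
have dVP (t : K) : 0 <= t -> is_derive t (1 : K) V (dV t).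
  by move=> /ode[]; exact: is_derive_chetaev.
have VP (t : K) : 0 <= t -> 0 < V t -> V t <= C /\ V t ^+ 2 <= C * dV t.
  by move=> /bnd[]; exact: growth.
rewrite -/(V 0) => V0; move: V dV V0 dVP VP => V dV V0 dVP VP.
have V_ge (t : K) : 0 <= t -> V 0 <= V t.
  apply: (le_of_derive_ge0 V0 dVP) => {}t t0 Vt.
  have [_] := VP t t0 Vt; rewrite -(pmulr_rge0 _ C0).
  by apply: le_trans; exact: sqr_ge0.
have dV_ge (t : K) : 0 <= t -> V 0 ^+ 2 <= C * dV t.
  move=> t0; have Vt := lt_le_trans V0 (V_ge t t0).
  have [_] := VP t t0 Vt; apply: le_trans.
  by rewrite lerXn2r ?nnegrE ?(ltW V0) ?(ltW Vt)// V_ge.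
have V20 : 0 < V 0 ^+ 2 by rewrite exprn_gt0.
(* At slope at least [V 0 ^+ 2 / C], [V] gains at least [C] by this time. *)
pose T := C ^+ 2 / V 0 ^+ 2.
have T0 : 0 < T by rewrite divr_gt0 ?exprn_gt0.
have [c /andP[/ltW c0 _]] := is_derive_MVT T0 dVP; rewrite subr0 => VT.
have [VTC _] := VP T (ltW T0) (lt_le_trans V0 (V_ge T (ltW T0))).
have : C * (V T - V 0) < C * C by rewrite ltr_pM2l// ltrBlDr ltr_pwDr.
rewrite VT mulrA ltNge => /negP; apply.
have : V 0 ^+ 2 * T <= C * dV c * T by rewrite ler_pM2r// dV_ge.
by apply: le_trans; rewrite /T mulrCA divff ?gt_eqF// mulr1 expr2.
Qed.

End Chetaev.

(** * Reduction of the affine equations *)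

Section AffineEquations.
Context {K : realType}.
Implicit Types (Q R : 'M[K]_3) (i j : 'I_3).

Lemma partial_linear_field Q j x : partial j (linear_field Q) x = col j Q.
Proof.
rewrite /partial /derive; apply: cvg_lim => //=; apply: cvg_near_cst.
near=> h.
rewrite /linear_field mulmxDr addrK -scalemxAr scalerA mulVf ?scale1r ?colE//.
by near: h; exact: nbhs_dnbhs_neq.
Unshelve. all: by end_near. Qed.

Lemma div_linear_field Q x : div (linear_field Q) x = \tr Q.
Proof. by apply: eq_bigr => i _; rewrite partial_linear_field mxE. Qed.

Lemma curl_linear_field Q x :
  curl (linear_field Q) x
  = \col_i (Q (i + 2%:R) (i + 1) - Q (i + 1) (i + 2%:R)).
Proof. by apply/colP => i; rewrite !mxE !partial_linear_field !mxE. Qed.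

Lemma advection_linear_field Q x :
  advection (linear_field Q) (linear_field Q) x = Q *m (Q *m x).
Proof.
apply/colP => i; rewrite summxE mxE; apply: eq_bigr => j _.
by rewrite partial_linear_field !mxE mulrC.
Qed.

Lemma is_derive_mx_entry m n (F : K -> 'M[K]_(m, n)) (t : K)
    (k : 'I_m) (l : 'I_n) : derivable F t 1 ->
  is_derive t (1 : K) (fun u => F u k l) (derive1 F t k l).
Proof.
move=> Ft; apply: DeriveDef; first exact: (derivable_mxP _ _ _).1.
by rewrite derive1E derive_mx// mxE.
Qed.

(** Evaluating the field equations at the basis vector [delta_mx j 0] extracts column [j]; the curl
    is constant in space, so the magnetic equation is read off at [x = 0]. *)
Lemma affine_solution_ode (s : K -> 'M[K]_3 * 'M[K]_3 * 'cV[K]_3) (t : K) :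
    affine_solution s -> 0 <= t ->
  [/\ forall i j, is_derive t (1 : K) (fun u => (s u).1.1 i j)
        (- (s t).1.2 i j - ((s t).1.1 *m (s t).1.1) i j
         - cross (col j (s t).1.1) (s t).2 i 0),
      forall i j, is_derive t (1 : K) (fun u => (s u).1.2 i j)
        ((1 - \tr (s t).1.2) * (s t).1.1 i j)
    & forall i, is_derive t (1 : K) (fun u => (s u).2 i 0)
        ((s t).1.2 (i + 1) (i + 2%:R) - (s t).1.2 (i + 2%:R) (i + 1))].
Proof.
move=> sol t0; split=> [i j|i j|i].
- have := is_derive_mx_entry i 0 (@V_derivable _ _ _ _ sol t (delta_mx j 0) t0).
  have /(canRL (addrK _)) -> := @momentum_eq _ _ _ _ sol t (delta_mx j 0) t0.
  rewrite advection_linear_field.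
  under eq_fun do rewrite /linear_field -colE mxE.
  congr is_derive; rewrite /linear_field -!colE !mxE.
  by under eq_bigr do rewrite mxE; ring.
- have := is_derive_mx_entry i 0 (@E_derivable _ _ _ _ sol t (delta_mx j 0) t0).
  have /(canRL (addrK _)) -> := @electric_eq _ _ _ _ sol t (delta_mx j 0) t0.
  rewrite div_linear_field.
  under eq_fun do rewrite /linear_field -colE mxE.
  by congr is_derive; rewrite /linear_field -!colE !mxE; ring.
- have := is_derive_mx_entry i 0 (@B_derivable _ _ _ _ sol t t0).
  have /(canRL (addrK _)) -> := @magnetic_eq _ _ _ _ sol t 0 t0.
  by congr is_derive; rewrite curl_linear_field !mxE; ring.
Qed.

End AffineEquations.

(** * Invariant classes of affine solutions *)

Section Reduction.
Context {K : realType}.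
Implicit Types (Q R : K -> 'M[K]_3).

Lemma ord3_add (i : 'I_3) : [/\ i + 1 + 1 = i + 2%:R, i + 1 + 2%:R = i,
  i + 2%:R + 1 = i & i + 2%:R + 2%:R = i + 1].
Proof. by split; apply/val_inj; case: i => -[|[|[|//]]] ?. Qed.

Lemma sum3 (F : 'I_3 -> K) i : \sum_k F k = F i + F (i + 1) + F (i + 2%:R).
Proof.
have h : \sum_k F k = F 0 + F 1 + F 2%:R.
  rewrite !big_ord_recl big_ord0 addr0 addrA.
  by congr (F _ + F _ + F _); exact/val_inj.
rewrite h; case: i => -[|[|[|//]]] hi;
  [|rewrite -addrA addrC|rewrite addrC addrA];
  by congr (F _ + F _ + F _); exact/val_inj.
Qed.

Definition vorticity (M : 'M[K]_3) i :=
  M (i + 2%:R) (i + 1) - M (i + 1) (i + 2%:R).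

Lemma is_derive_sum_sqr (I : Type) (l : seq I) (f df : I -> K -> K) (t : K) :
    (forall i, is_derive t (1 : K) (f i) (df i t)) ->
  is_derive t (1 : K) (fun u => \sum_(i <- l) f i u ^+ 2)
    (\sum_(i <- l) 2 * (f i t * df i t)).
Proof.
move=> fdf; elim: l => [|i l IH].
  by under eq_fun do rewrite big_nil; rewrite big_nil; exact: is_derive_cst.
under eq_fun do rewrite big_cons; rewrite big_cons.
by apply: is_derive_eq; rewrite /GRing.scale /=; ring.
Qed.

(** Uniqueness of the zero solution by an energy estimate: the sum of squares satisfies
    [E' <= 2 * C * #|I|%:R * E], and Gronwall applies. *)
Lemma linear_growth_eq0 (I : finType) (f df : I -> K -> K) (C : K) : 0 <= C ->
    (forall i (t : K), 0 <= t -> is_derive t (1 : K) (f i) (df i t)) ->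
    (forall i (t : K), 0 <= t -> `|df i t| <= C * \sum_j `|f j t|) ->
    (forall i, f i 0 = 0) ->
  forall i t, 0 <= t -> f i t = 0.
Proof.
move=> C0 fdf dfC f0 i t t0.
pose E t := \sum_i f i t ^+ 2.
suff Et : E t <= 0.
  apply/eqP; rewrite -sqrf_eq0 eq_le sqr_ge0 andbT; apply: le_trans Et.
  by rewrite /E (bigD1 i)//= lerDl sumr_ge0// => j _; exact: sqr_ge0.
apply: (@gronwall_le0 _ E (fun t => \sum_i 2 * (f i t * df i t))
  (2 * C * #|I|%:R)) t0.
- by move=> u u0; apply: is_derive_sum_sqr => j; exact: fdf.
- move=> u u0; have bound j : 2 * (f j u * df j u)
      <= \sum_k C * (f j u ^+ 2 + f k u ^+ 2).
    have h : f j u * df j u <= `|f j u| * (C * \sum_k `|f k u|).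
      by rewrite (le_trans (ler_norm _))// normrM ler_wpM2l// dfC.
    rewrite (le_trans (ler_wpM2l _ h))// !mulr_sumr ler_sum// => k _.
    rewrite [leLHS](_ : _ = C * (2 * (`|f j u| * `|f k u|))); last by ring.
    rewrite ler_wpM2l// -(real_normK (num_real (f j u))).
    rewrite -(real_normK (num_real (f k u))).
    by have := sqr_ge0 (`|f j u| - `|f k u|); lra.
  rewrite (le_trans (ler_sum _ (fun j _ => bound j)))//.
  under eq_bigr do
    rewrite -mulr_sumr big_split sumr_const -[_ *+ #|_|]mulr_natr /=.
  rewrite -mulr_sumr big_split /= -mulr_suml sumr_const -[_ *+ #|_|]mulr_natr.
  by rewrite /E le_eqVlt; apply/orP; left; apply/eqP; ring.
- by rewrite /E big1// => j _; rewrite f0 expr0n.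
Qed.

Lemma mxtrace_le (M : 'M[K]_3) : (forall i, `|M i i| <= 1) -> `|\tr M| <= 3.
Proof.
move=> M1; rewrite (le_trans (ler_norm_sum _ _ _))//.
by rewrite (le_trans (ler_sum _ (fun i _ => M1 i)))// sumr_const card_ord.
Qed.

(** The field [G = curl V - B] is frozen in: it solves the linear equation [G' = Q G - (tr Q) G],
    whose coefficients are bounded, and vanishes initially. *)
Lemma generalized_vorticity_eq0 (s : K -> 'M[K]_3 * 'M[K]_3 * 'cV[K]_3) :
    affine_solution s ->
    (forall (t : K) i j, 0 <= t -> `|(s t).1.1 i j| <= 1) ->
    (forall i, (s 0).2 i 0 = vorticity (s 0).1.1 i) ->
  forall (t : K) i, 0 <= t -> (s t).2 i 0 = vorticity (s t).1.1 i.
Proof.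
move=> sol Q1 init.
pose G i t := vorticity (s t).1.1 i - (s t).2 i 0.
pose dG i t := \sum_k (s t).1.1 i k * G k t - \tr (s t).1.1 * G i t.
suff G0 i t : 0 <= t -> G i t = 0.
  by move=> t i t0; apply/esym/eqP; rewrite -subr_eq0; apply/eqP/G0.
apply: (@linear_growth_eq0 _ G dG 4) => //.
- move=> {}i {}t t0; have [dQ _ dB] := affine_solution_ode sol t0.
  rewrite /G /vorticity; apply: is_derive_eq.
  have [e1 e2 e3 e4] := ord3_add i.
  rewrite /dG /mxtrace /G /vorticity !mxE !(sum3 _ i).
  by rewrite ?(e1, e2, e3, e4); ring.
- move=> {}i {}t t0; rewrite /dG (le_trans (ler_normB _ _))//.
  have -> : 4 = 1 + 3 :> K by ring.
  rewrite mulrDl mul1r lerD//.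
    rewrite (le_trans (ler_norm_sum _ _ _))// ler_sum// => k _.
    by rewrite normrM ler_piMl// Q1.
  rewrite normrM ler_pM//.
    by rewrite mxtrace_le// => k; exact: Q1.
  by rewrite (bigD1 i)//= lerDl sumr_ge0.
- by move=> {}i; rewrite /G init subrr.
Qed.

Definition potential_flow Q R := forall t : K, 0 <= t ->
  (forall i j, is_derive t (1 : K) (fun u => Q u i j)
     (- (\sum_k Q t k i * Q t k j) - R t i j)) /\
  (forall i j, is_derive t (1 : K) (fun u => R u i j)
     ((1 - \tr (R t)) * Q t i j)).

(** When [B = curl V], the magnetic force cancels the rotational part of the advection, leaving the
    gradient of [|V|^2 / 2], which is [Q^T Q x]. *)
Lemma affine_potential_flow (s : K -> 'M[K]_3 * 'M[K]_3 * 'cV[K]_3) :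
    affine_solution s ->
    (forall (t : K) i, 0 <= t -> (s t).2 i 0 = vorticity (s t).1.1 i) ->
  potential_flow (fun t => (s t).1.1) (fun t => (s t).1.2).
Proof.
move=> sol BQ t t0; have [dQ dR _] := affine_solution_ode sol t0.
split=> // i j; apply: is_derive_eq.
have [e1 e2 e3 e4] := ord3_add i.
rewrite !mxE !BQ// !(sum3 _ i) /vorticity ?(e1, e2, e3, e4); ring.
Qed.

(** The differences of two solutions solve a linear system with bounded coefficients. Uniqueness
    carries symmetries of the initial data to all later times. *)
Lemma potential_flow_unique Q R Q' R' :
    potential_flow Q R -> potential_flow Q' R' ->
    (forall (t : K) i j, 0 <= t -> `|Q t i j| <= 1) ->
    (forall (t : K) i j, 0 <= t -> `|R t i j| <= 1) ->
    (forall (t : K) i j, 0 <= t -> `|Q' t i j| <= 1) ->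
    (forall i j, Q 0 i j = Q' 0 i j) -> (forall i j, R 0 i j = R' 0 i j) ->
  forall (t : K) i j, 0 <= t -> Q t i j = Q' t i j /\ R t i j = R' t i j.
Proof.
move=> flow flow' Q1 R1 Q'1 Q0 R0 t i j t0.
pose f (x : bool * 'I_3 * 'I_3) t := let: (b, i, j) := x in
  if b then Q t i j - Q' t i j else R t i j - R' t i j.
pose df (x : bool * 'I_3 * 'I_3) t := let: (b, i, j) := x in
  if b then - \sum_k (Q t k i * f (true, k, j) t + Q' t k j * f (true, k, i) t)
            - f (false, i, j) t
  else (1 - \tr (R t)) * f (true, i, j) t
       - Q' t i j * \sum_k f (false, k, k) t.
have f_eq0 x : f x t = 0.
  (* Seven is [6 + 1] for the velocity entries (six products and one entry of [R]) and [4 + 3] for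
     the electric ones ([1 - tr R] and the trace of the difference). *)
  apply: (@linear_growth_eq0 _ f df 7) => //.
  - move=> [[[] k] l] u u0 /=; have [dQ dR] := flow u u0;
      have [dQ' dR'] := flow' u u0;
      by apply: is_derive_eq; rewrite /mxtrace !(sum3 _ 0); ring.
  - move=> x' u u0; set S := \sum_x _.
    have fS y : `|f y u| <= S by rewrite /S (bigD1 y)//= lerDl sumr_ge0.
    have S0 : 0 <= S by rewrite sumr_ge0.
    have aS (a : K) y : `|a| <= 1 -> `|a * f y u| <= S.
      by move=> a1; rewrite normrM -[S]mul1r ler_pM.
    case: x' => [[[] k] l]; rewrite (le_trans (ler_normB _ _))//.
      rewrite normrN.
      have -> : 7 = 6 + 1 :> K by ring.
      rewrite [leRHS]mulrDl mul1r lerD//.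
      rewrite (le_trans (ler_norm_sum _ _ _))//.
      have -> : 6 * S = \sum_(m < 3) (S + S).
        by rewrite sumr_const card_ord -mulr_natl; ring.
      rewrite ler_sum// => m _.
      by rewrite (le_trans (ler_normD _ _))// lerD// aS ?Q1 ?Q'1.
    have -> : 7 = 4 + 3 :> K by ring.
    rewrite [leRHS]mulrDl lerD//.
      rewrite normrM ler_pM//.
      rewrite (le_trans (ler_normB _ _))// normr1.
      by have := mxtrace_le (fun k => R1 u k k u0); lra.
    rewrite normrM -[leRHS]mul1r ler_pM// ?Q'1//.
    rewrite (le_trans (ler_norm_sum _ _ _))//.
    have -> : 3 * S = \sum_(m < 3) S by rewrite sumr_const card_ord mulr_natl.
    by rewrite ler_sum.
  - by move=> [[[] k] l] /=; rewrite ?Q0 ?R0 subrr.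
have := f_eq0 (true, i, j); have := f_eq0 (false, i, j).
by move=> /eqP; rewrite subr_eq0 => /eqP -> /eqP; rewrite subr_eq0 => /eqP ->.
Qed.



(* Conjugation by the quarter turn about the third axis: [1 - i] exchanges the
   indices 0 and 1 and fixes 2, since arithmetic in ['I_3] is modulo 3. *)
Definition quarter_turn (M : 'M[K]_3) : 'M[K]_3 := \matrix_(i, j)
  ((if i == 0 then -1 else 1) * (if j == 0 then -1 else 1)
   * M (1 - i) (1 - j)).

Lemma mxtrace_quarter_turn M : \tr (quarter_turn M) = \tr M.
Proof.
rewrite /mxtrace [RHS](reindex_inj (inv_inj (subKr 1)))/=.
by apply: eq_bigr => i _; rewrite mxE; case: ifP => _; ring.
Qed.

(** Conjugation by an orthogonal matrix respects [Q^T Q] and preserves the trace. *)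
Lemma potential_flow_quarter_turn Q R : potential_flow Q R ->
  potential_flow (fun t => quarter_turn (Q t)) (fun t => quarter_turn (R t)).
Proof.
move=> flow t t0; have [dQ dR] := flow t t0; split=> i j.
  under eq_fun do rewrite mxE; apply: is_derive_eq.
  rewrite /GRing.scale /= (reindex_inj (inv_inj (subKr 1)))/=.
  set a := if i == 0 then _ else _; set b := if j == 0 then _ else _.
  rewrite mxE mulrBr mulrN; congr (- _ - _).
  rewrite mulr_sumr; apply: eq_bigr => k _; rewrite !mxE -/a -/b.
  by case: ifP => _; ring.
under eq_fun do rewrite mxE; apply: is_derive_eq.
by rewrite mxtrace_quarter_turn mxE /GRing.scale /=; ring.
Qed.

Lemma norm_quarter_turn M i j : `|quarter_turn M i j| = `|M (1 - i) (1 - j)|.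
Proof.
by rewrite mxE !normrM; do 2!case: ifP => _; rewrite ?normrN !normr1 !mul1r.
Qed.

(** Invariance under one quarter turn already forces invariance under all rotations about the third
    axis; the last diagonal entry remains free. *)
Lemma quarter_turnE M : quarter_turn M = M ->
  [/\ M 0 0 = M 1 1, M 0 1 = - M 1 0, M 0 2%:R = 0 /\ M 1 2%:R = 0
    & M 2%:R 0 = 0 /\ M 2%:R 1 = 0].
Proof.
move=> /matrixP MM; have e2 : 1 - 2%:R = 2%:R :> 'I_3 by exact/val_inj.
have := MM 0 0; have := MM 0 1; have := MM 0 2%:R; have := MM 1 2%:R.
have := MM 2%:R 0; have := MM 2%:R 1.
rewrite !mxE !subrr !subr0 !e2 /= => *.
by split; [lra|lra|split; lra|split; lra].
Qed.

(** Uniqueness preserves the quarter-turn symmetry. The last diagonal entries then satisfy a closed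
    system and stay zero, so only [p], [r], [w], [s] remain. *)
Lemma planar_flow Q R : potential_flow Q R ->
    (forall (t : K) i j, 0 <= t -> `|Q t i j| <= 1) ->
    (forall (t : K) i j, 0 <= t -> `|R t i j| <= 1) ->
    quarter_turn (Q 0) = Q 0 -> quarter_turn (R 0) = R 0 ->
    Q 0 2%:R 2%:R = 0 -> R 0 2%:R 2%:R = 0 ->
  let p t := Q t 0 0 + Q t 1 1 in let r t := R t 0 0 + R t 1 1 in
  let w t := Q t 1 0 - Q t 0 1 in let s t := R t 1 0 - R t 0 1 in
  forall t : K, 0 <= t ->
  [/\ is_derive t (1 : K) p (- r t - (p t ^+ 2 + w t ^+ 2) / 2),
      is_derive t (1 : K) r ((1 - r t) * p t),
      is_derive t (1 : K) w (- s t)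
    & is_derive t (1 : K) s ((1 - r t) * w t)].
Proof.
move=> flow Q1 R1 Q0 R0 Q022 R022 p r w s.
have turn (t : K) : 0 <= t ->
    quarter_turn (Q t) = Q t /\ quarter_turn (R t) = R t.
  move=> t0; have turnt i j := @potential_flow_unique _ _ _ _
    (potential_flow_quarter_turn flow) flow _ _ Q1 _ _ t i j t0.
  have {}turnt i j : quarter_turn (Q t) i j = Q t i j
      /\ quarter_turn (R t) i j = R t i j.
    apply: turnt => [u k l u0|u k l u0|k l|k l]; rewrite ?norm_quarter_turn.
    - exact: Q1.
    - exact: R1.
    - by rewrite Q0.
    - by rewrite R0.
  by split; apply/matrixP => i j; have [] := turnt i j.
(* With [Q 0 2] and [Q 1 2] zero, this pair solves a linear system once one factor of the square is
   taken as a bounded coefficient. *)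
pose f (b : bool) t := if b then Q t 2%:R 2%:R else R t 2%:R 2%:R.
pose df (b : bool) t :=
  if b then - f true t * f true t - f false t else (1 - \tr (R t)) * f true t.
have f0 b (t : K) : 0 <= t -> f b t = 0.
  apply: (@linear_growth_eq0 _ f df 4) => // [{}b {}t t0|{}b {}t t0|].
  - have [dQ dR] := flow t t0.
    have [/quarter_turnE[_ _ [Q02 Q12] _] _] := turn t t0.
    case: b; rewrite /f /df; last exact: dR.
    by apply: is_derive_eq; rewrite (sum3 _ 0) !add0r Q02 Q12 /f; ring.
  - rewrite big_bool /=; have := mxtrace_le (fun k => R1 t k k t0).
    have := Q1 t 2%:R 2%:R t0; rewrite /df /f; case: b => Qt Rt.
      rewrite (le_trans (ler_normB _ _))// normrM normrN mulrDr lerD//.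
        by rewrite ler_pM//; lra.
      by have := normr_ge0 (R t 2%:R 2%:R); lra.
    have h : `|1 - \tr (R t)| <= 4.
      by rewrite (le_trans (ler_normB _ _))// normr1; lra.
    by rewrite normrM ler_pM// lerDl.
  - by case; rewrite /f.
move=> t t0; have [dQ dR] := flow t t0.
have [/quarter_turnE[Q00 Q01 [Q02 Q12] [Q20 Q21]]
      /quarter_turnE[R00 R01 [R02 R12] [R20 R21]]] := turn t t0.
have := f0 true t t0; have := f0 false t t0; rewrite /f => R22 Q22.
rewrite /p /r /w /s.
split; apply: is_derive_eq;
  rewrite /mxtrace !(sum3 _ 0) !add0r ?Q02 ?Q12 ?Q20 ?Q21 ?Q22 ?R22 ?Q00 ?Q01.
- by field.
- by ring.
- by ring.
- by ring.
Qed.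

(** Expansion [a] and rotation [b] in the horizontal plane: trace [2 * a], third vorticity component
    [2 * b]. *)
Definition planar (a b : K) : 'M[K]_3 := \matrix_(i, j)
  if (i == 2%:R) || (j == 2%:R) then 0
  else if i == j then a else if i == 0 then - b else b.

Lemma planar_le (a b c : K) i j : `|a| <= c -> `|b| <= c ->
  `|planar a b i j| <= c.
Proof.
move=> ac bc; have c0 := le_trans (normr_ge0 _) ac.
by rewrite mxE; do 3?case: ifP => _; rewrite ?normrN ?normr0.
Qed.

Lemma quarter_turn_planar a b : quarter_turn (planar a b) = planar a b.
Proof.
apply/matrixP => i j; rewrite !mxE.
by case: i j => -[|[|[|//]]] hi [] [|[|[|//]]] hj /=; ring.
Qed.

End Reduction.

(** * Unstable initial data *)

Theorem corollary1 (K : realType) :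
  lyapunov_unstable (@affine_data K) (@affine_solution K) (0, 0, 0).
Proof.
have [eta [C [/andP[eta0 eta1] C0 growth]]] := @chetaev_growth K.
have ball_le m n (M : 'M[K]_(m, n)) c i j : ball 0 c M -> `|M i j| <= c.
  by move=> [_ /(_ i j)]; rewrite mxE /ball /= sub0r normrN => /ltW.
(* Half of [eta], because [p], [r], [w], [s] are sums or differences of two entries. *)
exists (ball (0, 0, 0) (eta / 2)).
  by apply: nbhsx_ballx; rewrite divr_gt0.
move=> W /nbhs_ballP[e /= e0 eW].
pose d := Num.min e 1 / 2.
have d0 : 0 < d by rewrite divr_gt0// lt_min e0 ltr01.
have [de d1] : d < e /\ d < 1.
  have : Num.min e 1 <= e by rewrite ge_min lexx.
  have : Num.min e 1 <= 1 by rewrite ge_min lexx orbT.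
  by rewrite /d; split; lra.
(* Here [p = w = d], [r = - d], [s = 0], where the cubic correction vanishes and [chetaev] equals
   [d ^+ 2 * (3 - d ^+ 2) > 0]. *)
pose Q0 := planar (d / 2) (d / 2); pose R0 := planar (- d / 2) 0.
have d20 : 0 <= d / 2 by rewrite divr_ge0// ltW.
have Q0d i j : `|Q0 i j| <= d / 2 by apply: planar_le; rewrite ger0_norm.
have R0d i j : `|R0 i j| <= d / 2.
  by apply: planar_le; rewrite ?mulNr ?normrN ?normr0// ger0_norm.
exists (Q0, R0, \col_i vorticity Q0 i); split.
- apply: eW; split; first split.
  + split=> // i j; rewrite mxE /ball /= sub0r normrN.
    by rewrite (le_lt_trans (Q0d i j))//; lra.
  + split=> // i j; rewrite mxE /ball /= sub0r normrN.
    by rewrite (le_lt_trans (R0d i j))//; lra.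
  + split=> // i j; rewrite !mxE /ball /= sub0r normrN.
    rewrite (le_lt_trans (ler_normB _ _))//.
    by have := Q0d (i + 2%:R) (i + 1); have := Q0d (i + 1) (i + 2%:R); lra.
(* The initial density is [1 + d]. *)
- by move=> x /=; rewrite div_linear_field /mxtrace (sum3 _ 0) !mxE /=; lra.
move=> [s [sol s0 sU]].
have s_le (t : K) i j : 0 <= t ->
    `|(s t).1.1 i j| <= eta / 2 /\ `|(s t).1.2 i j| <= eta / 2.
  by move=> /sU[[Qt Rt] _]; split; apply: ball_le.
have Q1 (t : K) i j : 0 <= t -> `|(s t).1.1 i j| <= 1.
  by move=> /(s_le t i j)[h _]; lra.
have R1 (t : K) i j : 0 <= t -> `|(s t).1.2 i j| <= 1.
  by move=> /(s_le t i j)[_ h]; lra.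
have flow : potential_flow (fun t => (s t).1.1) (fun t => (s t).1.2).
  apply: (affine_potential_flow sol); apply: (generalized_vorticity_eq0 sol Q1).
  by move=> i; rewrite s0 mxE.
have := chetaev_unbounded C0 growth _ (planar_flow flow Q1 R1 _ _ _ _).
rewrite s0 /=; apply.
- have half (x y : K) : `|x| <= eta / 2 -> `|y| <= eta / 2 ->
      `|x + y| <= eta /\ `|x - y| <= eta.
    move=> hx hy; have := ler_normD x y; have := ler_normB x y.
    by move=> *; split; lra.
  move=> t t0; have h i j := s_le t i j t0.
  by split; [apply: (half _ _ _ _).1|apply: (half _ _ _ _).1
            |apply: (half _ _ _ _).2|apply: (half _ _ _ _).2];
    first [exact: (h _ _).1|exact: (h _ _).2].
- exact: quarter_turn_planar.
- exact: quarter_turn_planar.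
- by rewrite mxE.
- by rewrite mxE.
rewrite !mxE /=; set x := chetaev _ _ _ _.
have -> : x = d ^+ 2 * (3 - d ^+ 2).
  by rewrite /x /chetaev /chetaev2 /chetaev3 /chetaev4; field.
have d2 : d ^+ 2 <= 1 by rewrite exprn_ile1 ?ltW.
by rewrite mulr_gt0 ?exprn_gt0//; move: d2; clear; lra.
Qed.
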